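(* Let $m,n$ be arbitrary nonnegative integers and let $a,b,\beta$ be complex numbers such that $b,\,b+\beta\notin\{0,-1,-2,\ldots\}$ and $a\notin\{-1,-2,\ldots\}$. Then $$ \frac{a}{b(b+\beta)}\sum_{j=0}^{n}\frac{(a+b)_j(a+b+\beta)_{n-j}}{(b+1)_{j}(b+1+\beta)_{n-j}}\left\{(a+b+\beta+n-j)_{m+1}-(a+b+j)_{m+1}\right\} $$ $$ =(a+1)_m\sum_{k=0}^{m}\frac{(a+b)_k(a+b+\beta)_{m-k}}{(a+1)_{k}(a+1)_{m-k}}\left\{\frac{(a+b+k)_{n+1}}{(b)_{n+1}}-\frac{(a+b+\beta+m-k)_{n+1}}{(b+\beta)_{n+1}}\right\}. $$
   Context: $(p)_0=1$ and $(p)_n=p(p+1)\cdots(p+n-1)$ is the Pochhammer symbol. *)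

(* Defs.v *)
From mathcomp Require Import all_boot all_order all_algebra.
From mathcomp Require Export complex reals.

Set Implicit Arguments.
Unset Strict Implicit.
Unset Printing Implicit Defensive.

Import GRing.Theory.
Local Open Scope ring_scope.

(* The rising factorial (p)_n; the library's [x ^_ n] is the falling factorial
   on natural numbers only. *)
Definition pochhammer (F : fieldType) (p : F) (n : nat) : F :=
  \prod_(i < n) (p + i%:R).

(* Main.v *)
Require Import Defs.
From mathcomp Require Import all_boot all_order all_algebra.
From mathcomp Require Import complex reals.
From mathcomp Require Import ring.
Import GRing.Theory.
Local Open Scope ring_scope.
Local Open Scope complex_scope.

(** Put A = a+b, B = a+b+beta, c = b, d = b+beta and
    T_j = sum_k w_k (A)_(k+j) (B)_(m-k+n+1-j) / ((c)_j (d)_(n+1-j)), where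
    w_k = (a+1)_m / ((a+1)_k (a+1)_(m-k)).  The right-hand side is
    T_(n+1) - T_0.  Since A - c = B - d = a,
    (A+k+j)(d+n-j) - (B+m-k+n-j)(c+j)
      = (a+k)(B+m-k+n-j) - (a+m-k)(A+k+j),
    and w_(k+1) (a+k+1) = w_k (a+m-k), so the sum over k defining T_(j+1) - T_j
    telescopes too, down to the j-th term of the left-hand side. *)

Section Pochhammer.

Variable F : fieldType.
Implicit Types p a A B c d : F.

Lemma pochhammer0 p : pochhammer p 0 = 1.
Proof. by rewrite /pochhammer big_ord0. Qed.

Lemma pochhammerS p n : pochhammer p n.+1 = pochhammer p n * (p + n%:R).
Proof. by rewrite /pochhammer big_ord_recr. Qed.

Lemma pochhammerD p i j :
  pochhammer p (i + j) = pochhammer p i * pochhammer (p + i%:R) j.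
Proof.
elim: j => [|j IHj]; first by rewrite addn0 pochhammer0 mulr1.
by rewrite addnS !pochhammerS IHj natrD addrA mulrA.
Qed.

Lemma pochhammerSl p n : pochhammer p n.+1 = p * pochhammer (p + 1) n.
Proof. by rewrite -add1n pochhammerD pochhammerS pochhammer0 mul1r addr0. Qed.

Lemma pochhammer_neq0 p n :
  (forall k : nat, p <> - k%:R) -> pochhammer p n != 0.
Proof.
move=> hp; apply/prodf_neq0 => i _.
by rewrite addr_eq0; apply/eqP.
Qed.

Lemma addr1_neq_oppn p :
  (forall k : nat, p <> - k.+1%:R) -> forall k : nat, p + 1 <> - k%:R.
Proof.
by move=> hp k /eqP; rewrite -addr_eq0 -addrA nat1r addr_eq0 => /eqP; apply: hp.
Qed.

(** The weight w_k, a deformation of the binomial coefficient, which it equals at [a = 0]. *)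
Definition pochhammer_weight a m k : F :=
  pochhammer (a + 1) m / (pochhammer (a + 1) k * pochhammer (a + 1) (m - k)).

Lemma pochhammer_weightS a m k :
    (forall i : nat, a <> - i.+1%:R) -> (k < m)%N ->
  (a + k.+1%:R) * pochhammer_weight a m k.+1
  = (a + (m - k)%:R) * pochhammer_weight a m k.
Proof.
move=> ha lt_km; rewrite /pochhammer_weight -(subnSK lt_km) !pochhammerS.
have ha1 := addr1_neq_oppn _ ha.
have nz i : a + 1 + i%:R != 0 by rewrite addr_eq0; apply/eqP.
have nzp i : pochhammer (a + 1) i != 0 by apply: pochhammer_neq0.
rewrite -[k.+1%:R]nat1r -[(m - k.+1).+1%:R]nat1r !addrA.
by field; rewrite !nz !nzp.
Qed.

(** Summation by parts: for k < m the total coefficient of x_(k+1) is w_(k+1) (a+k+1) - w_k (a+m-k)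
    = 0. Only x_0 and x_(m+1) survive, each with a factor [a] since w_0 = w_m = 1. *)
Lemma sum_pochhammer_weight a m (x : nat -> F) :
    (forall i : nat, a <> - i.+1%:R) ->
  \sum_(0 <= k < m.+1) pochhammer_weight a m k
     * ((a + k%:R) * x k - (a + (m - k)%:R) * x k.+1)
  = a * (x 0%N - x m.+1).
Proof.
move=> ha.
have nzp i : pochhammer (a + 1) i != 0.
  by apply/pochhammer_neq0/addr1_neq_oppn.
have w0 : pochhammer_weight a m 0 = 1.
  by rewrite /pochhammer_weight pochhammer0 mul1r subn0 divff.
have wm : pochhammer_weight a m m = 1.
  by rewrite /pochhammer_weight subnn pochhammer0 mulr1 divff.
under eq_bigr do rewrite mulrBr.
rewrite sumrB big_nat_recl // [X in _ - X]big_nat_recr //= w0 wm subnn.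
rewrite (eq_big_nat _ _ (F2 := fun k =>
  pochhammer_weight a m k * ((a + (m - k)%:R) * x k.+1))).
  by ring.
by move=> k /andP[_ lt_km]; rewrite !mulrA ![_ * (a + _)]mulrC pochhammer_weightS.
Qed.

(** This is T_j; writing A and B as [a + c] and [a + d] builds in A - c = B - d = a. *)
Definition pochhammer_potential a c d m n j : F :=
  \sum_(0 <= k < m.+1) pochhammer_weight a m k
    * (pochhammer (a + c) (k + j) * pochhammer (a + d) (m - k + (n.+1 - j))
       / (pochhammer c j * pochhammer d (n.+1 - j))).

Lemma pochhammer_potentialB a c d m n j :
    (forall k : nat, c <> - k%:R) -> (forall k : nat, d <> - k%:R) ->
    (forall k : nat, a <> - k.+1%:R) -> (j <= n)%N ->
  pochhammer_potential a c d m n j.+1 - pochhammer_potential a c d m n j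
  = a * (pochhammer (a + c) j * pochhammer (a + d) (m.+1 + (n - j))
         - pochhammer (a + c) (m.+1 + j) * pochhammer (a + d) (n - j))
      / (pochhammer c j.+1 * pochhammer d (n - j).+1).
Proof.
move=> hc hd ha le_jn; rewrite /pochhammer_potential subSS subSn //.
set l := (n - j)%N.
(* Over the denominator (c)_(j+1) (d)_(l+1), the k-th term of the difference has numerator w_k
   (A)_(k+j) (B)_(m-k+l) ((A+k+j)(d+l) - (B+m-k+l)(c+j)), which is w_k ((a+k) x_k - (a+m-k) x_(k+1))
   for this [x]. *)
pose x k := pochhammer (a + c) (k + j) * pochhammer (a + d) (m.+1 - k + l).
have := sum_pochhammer_weight a m x ha.
(* Only the boundary values [x 0] and [x m.+1] are unfolded, not those under the sum. *)
rewrite {3 4}/x subn0 subnn !add0n => <-.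
rewrite -sumrB mulr_suml; apply: eq_big_nat => k /andP[_ lt_km].
rewrite /x subSS subSn // addnS !addSn !pochhammerS.
have nz0 p i : (forall k : nat, p <> - k%:R) -> p + i%:R != 0.
  by move=> hp; rewrite addr_eq0; apply/eqP.
rewrite !natrD addnS pochhammerS natrD.
by field; rewrite !nz0 // !pochhammer_neq0.
Qed.

Lemma pochhammer_reciprocity a c d m n :
    (forall k : nat, c <> - k%:R) -> (forall k : nat, d <> - k%:R) ->
    (forall k : nat, a <> - k.+1%:R) ->
  a / (c * d) *
    \sum_(0 <= j < n.+1)
      pochhammer (a + c) j * pochhammer (a + d) (n - j)
        / (pochhammer (c + 1) j * pochhammer (d + 1) (n - j))
      * (pochhammer (a + d + (n - j)%:R) m.+1
         - pochhammer (a + c + j%:R) m.+1)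
  = pochhammer (a + 1) m *
    \sum_(0 <= k < m.+1)
      pochhammer (a + c) k * pochhammer (a + d) (m - k)
        / (pochhammer (a + 1) k * pochhammer (a + 1) (m - k))
      * (pochhammer (a + c + k%:R) n.+1 / pochhammer c n.+1
         - pochhammer (a + d + (m - k)%:R) n.+1 / pochhammer d n.+1).
Proof.
move=> hc hd ha.
transitivity (pochhammer_potential a c d m n n.+1
              - pochhammer_potential a c d m n 0).
  rewrite -(telescope_sumr _ (leq0n n.+1)) mulr_sumr.
  apply: eq_big_nat => j /andP[_ le_jn].
  (* The sums are commuted so that [pochhammerD] splits off (A)_j and (B)_(n-j); the prefactor
     1/(cd) comes from (c)_(j+1) = c (c+1)_j and its analogue for [d]. *)
  rewrite pochhammer_potentialB // [(m.+1 + (n - j))%N]addnC.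
  rewrite [(m.+1 + j)%N]addnC !pochhammerD (pochhammerSl c) (pochhammerSl d).
  by rewrite !invfM; ring.
rewrite /pochhammer_potential -sumrB mulr_sumr.
apply: eq_bigr => k _.
rewrite subnn subn0 !addn0 !pochhammerD !pochhammer0 /pochhammer_weight.
by rewrite !invfM invr1; ring.
Qed.

End Pochhammer.

Theorem corollary5 (R : realType) (m n : nat) (a b beta : R[i])
    (hb : forall k : nat, b <> - k%:R)
    (hbbeta : forall k : nat, b + beta <> - k%:R)
    (ha : forall k : nat, a <> - k.+1%:R) :
  a / (b * (b + beta)) *
    \sum_(0 <= j < n.+1)
      pochhammer (a + b) j * pochhammer (a + b + beta) (n - j)
        / (pochhammer (b + 1) j * pochhammer (b + 1 + beta) (n - j))
      * (pochhammer (a + b + beta + (n - j)%:R) m.+1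
         - pochhammer (a + b + j%:R) m.+1)
  = pochhammer (a + 1) m *
    \sum_(0 <= k < m.+1)
      pochhammer (a + b) k * pochhammer (a + b + beta) (m - k)
        / (pochhammer (a + 1) k * pochhammer (a + 1) (m - k))
      * (pochhammer (a + b + k%:R) n.+1 / pochhammer b n.+1
         - pochhammer (a + b + beta + (m - k)%:R) n.+1
           / pochhammer (b + beta) n.+1).
Proof.
(* Specialization to c = b and d = b + beta. *)
rewrite -[a + b + beta]addrA [b + 1 + beta]addrAC.
exact: pochhammer_reciprocity.
Qed.
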